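(* Let $\varphi^\star$ be an $\varepsilon$-optimal solution of the problem of minimizing $\mathcal{L}_{\text{agg}}(\varphi)$ subject to $\|\varphi\|_\infty\le\delta$, let $\mathcal{Z}^\star=\{z_i'=F_\theta(t(x_i;\varphi^\star))\}$ be the triggered feature set of a mini-batch $\{x_i\}_{i=1}^B$, with centroid $\bar z^\star$ and radius $r=\max_i\|z_i'-\bar z^\star\|_2$. Assume: (i) the class prototypes exhibit angular separability, $\max_{c\ne c'}\cos(\mu_c,\mu_{c'})\le\gamma<1$; (ii) the aggregation objective satisfies $\mathcal{L}_{\text{agg}}(\varphi^\star)\le\varepsilon$, yielding a radius bound $r\le R(\varepsilon)$; (iii) (prototype balance) $\max_{c_1,c_2}|\Delta_{c_1,c_2}(\bar z^\star)|\le\kappa$. Then for every triggered feature $z_i'\in\mathcal{Z}^\star$ and for every pair of classes $(c_1,c_2)$, $$\Bigl|\Bigl\langle z_i'-\tfrac{\mu_{c_1}+\mu_{c_2}}{2},\ \tfrac{\mu_{c_1}-\mu_{c_2}}{\|\mu_{c_1}-\mu_{c_2}\|_2}\Bigr\rangle\Bigr|\ \le\ \kappa+R(\varepsilon),$$ i.e. $z_i'\in\mathcal{B}_{\tilde\varepsilon}(c_1,c_2)$ with $\tilde\varepsilon=\kappa+R(\varepsilon)$ simultaneously for all class pairs. The set $\mathcal{B}_{\tilde\varepsilon}=\bigcap_{c_1<c_2}\mathcal{B}_{\tilde\varepsilon}(c_1,c_2)$ is called the multi-class ambiguous band induced by the trigger.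
   Context: $F_\theta:\mathbb{R}^{d_x}\to\mathbb{R}^{d_f}$ is a fixed feature extractor (the penultimate-layer features of a surrogate model). For a class $c$, the prototype is $\mu_c=\mathbb{E}[F_\theta(x)\mid y=c]\in\mathbb{R}^{d_f}$, where $(x,y)$ is a labelled sample; class pairs $(c_1,c_2)$ are pairs of distinct classes. The trigger function is $t(x;\varphi)=(1-\alpha)x+\alpha\varphi$ with fixed $\alpha\in(0,1]$ and learnable pattern $\varphi\in\mathbb{R}^{d_x}$; $\delta$ is the bound on $\|\varphi\|_\infty$. The aggregation loss is $$\mathcal{L}_{\text{agg}}(\varphi)=\mathbb{E}_{x_i\ne x_j}\bigl[\|F_\theta(t(x_i;\varphi))-F_\theta(t(x_j;\varphi))\|_2\bigr],$$ the mean over pairs of distinct samples. $R(\varepsilon)$ denotes the bound on the cluster radius $r$ that $\mathcal{L}_{\text{agg}}(\varphi^\star)\le\varepsilon$ is assumed to give in (ii). The signed projection of $\bar z^\star$ onto the direction connecting two prototypes is $$\Delta_{c_1,c_2}(\bar z^\star)=\frac{\bigl\langle\bar z^\star-\frac{\mu_{c_1}+\mu_{c_2}}{2},\ \mu_{c_1}-\mu_{c_2}\bigr\rangle}{\|\mu_{c_1}-\mu_{c_2}\|_2}.$$ For $\varepsilon'>0$, the ambiguous boundary band of the class pair $(c_1,c_2)$ is $$\mathcal{B}_{\varepsilon'}(c_1,c_2)=\Bigl\{z:\Bigl|\Bigl\langle z-\tfrac{\mu_{c_1}+\mu_{c_2}}{2},\ \mu_{c_1}-\mu_{c_2}\Bigr\rangle\Bigr|\le\varepsilon'\Bigr\},$$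 with the direction $\mu_{c_1}-\mu_{c_2}$ not normalized.
   Formalization: As the band uses the unnormalized direction, the ''i.e.'' membership fails in general; proved are the displayed inequality, membership with half-width (κ+R(ε))‖μ_{c1}−μ_{c2}‖, and the literal band (and multi-class band) when the prototype distances are at most 1. *)

(* Defs.v *)
From HB Require Import structures.
From mathcomp Require Import all_boot all_order all_algebra.
From mathcomp Require Import all_classical all_reals all_analysis.

Set Implicit Arguments.
Unset Strict Implicit.
Unset Printing Implicit Defensive.

Import Order.TTheory GRing.Theory Num.Theory.
Import numFieldNormedType.Exports.

Local Open Scope classical_set_scope.
Local Open Scope ring_scope.

(* The library norm `|u| on 'rV[R]_n is the sup norm, which is the one wanted
   for the constraint on the pattern; the Euclidean structure is set up here. *)
Definition dotv (R : realType) (n : nat) (u v : 'rV[R]_n) : R :=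
  \sum_(j < n) u 0 j * v 0 j.

Definition norm2 (R : realType) (n : nat) (u : 'rV[R]_n) : R :=
  Num.sqrt (dotv u u).

(* Equal to 0 when u or v is 0, since x / 0 = 0. *)
Definition cosv (R : realType) (n : nat) (u v : 'rV[R]_n) : R :=
  dotv u v / (norm2 u * norm2 v).

Definition trigger (R : realType) (dx : nat) (alpha : R)
    (x phi : 'rV[R]_dx) : 'rV[R]_dx :=
  (1 - alpha) *: x + alpha *: phi.

(* E[F(X) | Y = c], componentwise, as the integral over the event {Y = c}
   divided by its probability. *)
Definition prototype (R : realType) (d : measure_display)
    (Omega : measurableType d) (P : probability Omega R) (dx df K : nat)
    (F : 'rV[R]_dx -> 'rV[R]_df) (X : Omega -> 'rV[R]_dx) (Y : Omega -> 'I_K)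
    (c : 'I_K) : 'rV[R]_df :=
  \row_j ((\int[P]_(w in Y @^-1` [set c]) (F (X w) 0 j))
          / fine (P (Y @^-1` [set c]))).

(* Mean over the ordered pairs (i, j) with S i != S j; the summand being
   symmetric, unordered pairs give the same mean.  It is 0 if there is no such
   pair. *)
Definition agg_loss (R : realType) (dx df N : nat)
    (F : 'rV[R]_dx -> 'rV[R]_df) (alpha : R) (S : 'I_N -> 'rV[R]_dx)
    (phi : 'rV[R]_dx) : R :=
  (\sum_(p : 'I_N * 'I_N | S p.1 != S p.2)
      norm2 (F (trigger alpha (S p.1) phi) - F (trigger alpha (S p.2) phi)))
  / (#|[pred p : 'I_N * 'I_N | S p.1 != S p.2]|)%:R.

Definition eps_optimal (R : realType) (n : nat) (L : 'rV[R]_n -> R)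
    (delta eps : R) (phi : 'rV[R]_n) : Prop :=
  `|phi| <= delta /\
  forall psi : 'rV[R]_n, `|psi| <= delta -> L phi <= L psi + eps.

Definition centroid (R : realType) (n B : nat) (z : 'I_B -> 'rV[R]_n) :
    'rV[R]_n :=
  B%:R^-1 *: \sum_(i < B) z i.

Definition cluster_radius (R : realType) (n B : nat) (z : 'I_B -> 'rV[R]_n) : R :=
  \big[Num.max/0]_(i < B) norm2 (z i - centroid z).

Definition midpoint (R : realType) (n : nat) (u v : 'rV[R]_n) : 'rV[R]_n :=
  2^-1 *: (u + v).

Definition signed_proj (R : realType) (n K : nat) (mu : 'I_K -> 'rV[R]_n)
    (c1 c2 : 'I_K) (z : 'rV[R]_n) : R :=
  dotv (z - midpoint (mu c1) (mu c2)) (mu c1 - mu c2)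
  / norm2 (mu c1 - mu c2).

(* The direction mu c1 - mu c2 is not normalized. *)
Definition ambiguous_band (R : realType) (n K : nat) (mu : 'I_K -> 'rV[R]_n)
    (e : R) (c1 c2 : 'I_K) : set 'rV[R]_n :=
  [set z | `|dotv (z - midpoint (mu c1) (mu c2)) (mu c1 - mu c2)| <= e].

Definition multi_class_ambiguous_band (R : realType) (n K : nat)
    (mu : 'I_K -> 'rV[R]_n) (e : R) : set 'rV[R]_n :=
  [set z | forall c1 c2 : 'I_K, (c1 < c2)%N -> ambiguous_band mu e c1 c2 z].

(* Main.v *)
(** Relative to the unit vector e in the direction mu c1 - mu c2, split
    z i - midpoint = (z i - centroid) + (centroid - midpoint).  By Cauchy-Schwarz
    the first term contributes at most the cluster radius, and the second
    contributes exactly the signed projection of the centroid, which prototype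
    balance bounds.  The junk value 0^-1 = 0 makes e = 0 when the two prototypes
    coincide, so this case needs no separate hypothesis. *)

Require Import Defs.
From HB Require Import structures.
From mathcomp Require Import all_boot all_order all_algebra.
From mathcomp Require Import all_classical all_reals all_analysis.
From mathcomp Require Import ring.

Set Implicit Arguments.
Unset Strict Implicit.
Unset Printing Implicit Defensive.

Import Order.TTheory GRing.Theory Num.Theory.
Import numFieldNormedType.Exports.

Local Open Scope classical_set_scope.
Local Open Scope ring_scope.

Lemma dotvC (R : realType) (n : nat) (u v : 'rV[R]_n) : dotv u v = dotv v u.
Proof. by apply: eq_bigr => j _; rewrite mulrC. Qed.

Lemma dotvDl (R : realType) (n : nat) (u v w : 'rV[R]_n) :
  dotv (u + v) w = dotv u w + dotv v w.
Proof. by rewrite -big_split; apply: eq_bigr => j _; rewrite mxE mulrDl. Qed.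

Lemma dotvZl (R : realType) (n : nat) (a : R) (u v : 'rV[R]_n) :
  dotv (a *: u) v = a * dotv u v.
Proof. by rewrite mulr_sumr; apply: eq_bigr => j _; rewrite mxE mulrA. Qed.

Lemma dotvZr (R : realType) (n : nat) (a : R) (u v : 'rV[R]_n) :
  dotv u (a *: v) = a * dotv u v.
Proof. by rewrite dotvC dotvZl dotvC. Qed.

Lemma dotv_ge0 (R : realType) (n : nat) (u : 'rV[R]_n) : 0 <= dotv u u.
Proof. by apply: sumr_ge0 => j _; rewrite -expr2 sqr_ge0. Qed.

Lemma dotv_eq0 (R : realType) (n : nat) (u : 'rV[R]_n) :
  (dotv u u == 0) = (u == 0).
Proof.
(* For the converse, the zero vector is rewritten as [0 *: 0], so that [dotvZl] extracts a zero
   factor. *)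
apply/eqP/eqP => [u0|->]; last by rewrite -(scale0r 0) dotvZl mul0r.
apply/rowP => j; rewrite mxE; apply/eqP.
rewrite -sqrf_eq0 expr2; apply/eqP.
by apply: (psumr_eq0P _ u0) => // i _; rewrite -expr2 sqr_ge0.
Qed.

Lemma norm2_ge0 (R : realType) (n : nat) (u : 'rV[R]_n) : 0 <= norm2 u.
Proof. exact: sqrtr_ge0. Qed.

Lemma norm2_eq0 (R : realType) (n : nat) (u : 'rV[R]_n) :
  (norm2 u == 0) = (u == 0).
Proof. by rewrite sqrtr_eq0 le_eqVlt ltNge dotv_ge0 orbF dotv_eq0. Qed.

(** Cauchy-Schwarz: for [v != 0], the vector [dotv v v *: u - dotv u v *: v] has square norm
    [dotv v v] times the right side minus the left, and [dotv v v] is positive. *)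
Lemma dotv_sqr_le (R : realType) (n : nat) (u v : 'rV[R]_n) :
  dotv u v ^+ 2 <= dotv u u * dotv v v.
Proof.
have [->|v0] := eqVneq v 0; first by rewrite -(scale0r 0) !dotvZr !mul0r expr0n mulr0.
have vv_gt0 : 0 < dotv v v by rewrite lt_def dotv_eq0 v0 dotv_ge0.
have := dotv_ge0 (dotv v v *: u + (- dotv u v) *: v).
rewrite dotvDl !dotvZl !(dotvC _ (_ + _)) !dotvDl !dotvZl (dotvC v u).
set a := dotv v v; set c := dotv u v; set e := dotv u u.
have -> : a * (a * e + - c * c) + - c * (a * c + - c * a) = a * (e * a - c ^+ 2).
  by ring.
by rewrite pmulr_rge0 // subr_ge0.
Qed.

Lemma normr_dotv_le (R : realType) (n : nat) (u v : 'rV[R]_n) :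
  `|dotv u v| <= norm2 u * norm2 v.
Proof.
by rewrite -sqrtr_sqr -sqrtrM ?dotv_ge0 // ler_wsqrtr // dotv_sqr_le.
Qed.

Lemma normr_dotv_unit_le (R : realType) (n : nat) (u v : 'rV[R]_n) :
  `|dotv u ((norm2 v)^-1 *: v)| <= norm2 u.
Proof.
have [->|v0] := eqVneq v 0.
  by rewrite scaler0 -(scale0r 0) dotvZr mul0r normr0 norm2_ge0.
have nv_gt0 : 0 < norm2 v by rewrite lt_def norm2_eq0 v0 norm2_ge0.
rewrite dotvZr mulrC normrM normfV (gtr0_norm nv_gt0) ler_pdivrMr //.
exact: normr_dotv_le.
Qed.

(** Carries bounds along the unit direction over to the unnormalized one; for [v = 0] both sides
    vanish. *)
Lemma dotv_unitE (R : realType) (n : nat) (u v : 'rV[R]_n) :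
  dotv u v = dotv u ((norm2 v)^-1 *: v) * norm2 v.
Proof.
have [->|v0] := eqVneq v 0; first by rewrite scaler0 -(scale0r 0) dotvZr !mul0r.
by rewrite dotvZr mulrC mulVKf // norm2_eq0.
Qed.

Lemma le_cluster_radius (R : realType) (n B : nat) (z : 'I_B -> 'rV[R]_n) i :
  norm2 (z i - centroid z) <= cluster_radius z.
Proof. exact: (le_bigmax _ (fun i => norm2 (z i - centroid z))). Qed.

Theorem proposition2 (R : realType) (d : measure_display)
    (Omega : measurableType d) (P : probability Omega R)
    (dx df K N B : nat)
    (F : 'rV[R]_dx -> 'rV[R]_df)
    (* labelled sample (x, y), and its class prototypes *)
    (X : Omega -> 'rV[R]_dx) (Y : Omega -> 'I_K)
    (mY : forall c : 'I_K, measurable (Y @^-1` [set c]))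
    (Ypos : forall c : 'I_K, (0 < P (Y @^-1` [set c]))%E)
    (intF : forall (c : 'I_K) (j : 'I_df),
      P.-integrable (Y @^-1` [set c]) (fun w => (F (X w) 0 j)%:E))
    (mu : 'I_K -> 'rV[R]_df)
    (muE : forall c : 'I_K, mu c = prototype P F X Y c)
    (alpha : R) (alpha_gt0 : 0 < alpha) (alpha_le1 : alpha <= 1)
    (* samples over which the aggregation loss is averaged *)
    (S : 'I_N -> 'rV[R]_dx)
    (delta eps : R) (phi : 'rV[R]_dx)
    (phi_opt : eps_optimal (agg_loss F alpha S) delta eps phi)
    (* mini-batch drawn from these samples, and its triggered features *)
    (b : 'I_B -> 'I_N) (z : 'I_B -> 'rV[R]_df)
    (zE : forall i : 'I_B, z i = F (trigger alpha (S (b i)) phi))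
    (gamma kappa : R) (Rad : R -> R)
    (gamma_lt1 : gamma < 1)
    (separable : forall c c' : 'I_K, c != c' -> cosv (mu c) (mu c') <= gamma)
    (agg_le : agg_loss F alpha S phi <= eps)
    (agg_radius : agg_loss F alpha S phi <= eps -> cluster_radius z <= Rad eps)
    (balanced : forall c1 c2 : 'I_K, c1 != c2 ->
      `|signed_proj mu c1 c2 (centroid z)| <= kappa) :
  [/\ forall (i : 'I_B) (c1 c2 : 'I_K), c1 != c2 ->
        `|dotv (z i - midpoint (mu c1) (mu c2))
               ((norm2 (mu c1 - mu c2))^-1 *: (mu c1 - mu c2))|
          <= kappa + Rad eps,
      (* the same, as membership in the bands with unnormalized direction *)
      forall (i : 'I_B) (c1 c2 : 'I_K), c1 != c2 ->
        ambiguous_band mu ((kappa + Rad eps) * norm2 (mu c1 - mu c2)) c1 c2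
          (z i),
      forall (i : 'I_B) (c1 c2 : 'I_K), c1 != c2 ->
        norm2 (mu c1 - mu c2) <= 1 ->
        ambiguous_band mu (kappa + Rad eps) c1 c2 (z i)
    & (forall c1 c2 : 'I_K, (c1 < c2)%N -> norm2 (mu c1 - mu c2) <= 1) ->
      forall i : 'I_B,
        multi_class_ambiguous_band mu (kappa + Rad eps) (z i)].
Proof.
have unit_le (i : 'I_B) (c1 c2 : 'I_K) : c1 != c2 ->
    `|dotv (z i - midpoint (mu c1) (mu c2))
           ((norm2 (mu c1 - mu c2))^-1 *: (mu c1 - mu c2))| <= kappa + Rad eps.
  move=> c12.
  (* The swap puts the centroid term first, to pair it with [kappa] and the deviation from the
     centroid with [Rad eps]. *)
  rewrite -(subrKA (centroid z)) dotvDl addrC.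
  apply: le_trans (ler_normD _ _) (lerD _ _).
    (* Pulling out the inverse norm leaves the quotient that defines [signed_proj]. *)
    by rewrite dotvZr mulrC; exact: balanced.
  apply: le_trans (normr_dotv_unit_le _ _) _.
  exact: le_trans (le_cluster_radius z i) (agg_radius agg_le).
have band (i : 'I_B) (c1 c2 : 'I_K) : c1 != c2 ->
    ambiguous_band mu ((kappa + Rad eps) * norm2 (mu c1 - mu c2)) c1 c2 (z i).
  move=> c12; rewrite /ambiguous_band /= dotv_unitE normrM.
  by rewrite (ger0_norm (norm2_ge0 _)) ler_wpM2r ?norm2_ge0 // unit_le.
have band1 (i : 'I_B) (c1 c2 : 'I_K) : c1 != c2 ->
    norm2 (mu c1 - mu c2) <= 1 ->
    ambiguous_band mu (kappa + Rad eps) c1 c2 (z i).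
  move=> c12 le1; apply: le_trans (band i c1 c2 c12) _.
  (* Shrinking by a factor at most 1 requires [0 <= kappa + Rad eps], which holds because [unit_le]
     bounds an absolute value by it. *)
  by rewrite ler_piMr // (le_trans _ (unit_le i c1 c2 c12)).
split=> // le1 i c1 c2 c12; apply: band1; last exact: le1.
by rewrite -val_eqE neq_ltn c12.
Qed.
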